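(* Let $(p_n)$, $(q_n)$ be sequences with $0<q_n<p_n\le1$ such that $st\text{-}\lim_{n\to\infty}q_n=1$, $st\text{-}\lim_{n\to\infty}q_n^n=a$, $st\text{-}\lim_{n\to\infty}p_n=1$, $st\text{-}\lim_{n\to\infty}p_n^n=b$. Then for all $f\in C[0,1]$, $$st\text{-}\lim_{n\to\infty}\left\|\widetilde{M}_{n,k}^{(p_n,q_n)}(f;\cdot)-f\right\|_{C[0,1]}=0.$$
   Context: A real sequence $(x_n)$ is statistically convergent to $L$, written $st\text{-}\lim_n x_n=L$, if for every $\varepsilon>0$ the set $S=\{n\in\mathbb{N}:|x_n-L|\ge\varepsilon\}$ has natural density $0$, i.e. $\lim_{N\to\infty}\frac1N\#\{j\le N: j\in S\}=0$. $\|\cdot\|_{C[0,1]}$ is the supremum norm on $[0,1]$. For $0<q<p\le1$: $[n]_{p,q}=\frac{p^n-q^n}{p-q}$; $[n]_{p,q}!=[1]_{p,q}\cdots[n]_{p,q}$, $[0]_{p,q}!=1$; $\begin{bmatrix}n\\k\end{bmatrix}_{p,q}=\frac{[n]_{p,q}!}{[k]_{p,q}![n-k]_{p,q}!}$; $(x+y)_{p,q}^n=\prod_{j=0}^{n-1}(p^jx+q^jy)$. The $(p,q)$-integral is $\int_0^a f(t)\,d_{p,q}t=(p-q)a\sum_{j=0}^\infty \frac{q^j}{p^{j+1}}f\!\left(\frac{q^j}{p^{j+1}}a\right)$. Define $m_{n,k}^{(p,q)}(x)=\frac{1}{p^{kn+n(n+1)/2}}\begin{bmatrix}n+k\\k\end{bmatrix}_{p,q}x^k(1-x)^{n+1}_{p,q}$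 and $b_{n,k}^{(p,q)}(qt)=\frac{1}{p^{k(n-1)+n(n-1)/2}}\begin{bmatrix}n+k+1\\k\end{bmatrix}_{p,q}(qt)^k(1-qt)^n_{p,q}$. The operator is $$\widetilde{M}_{n,k}^{(p,q)}(f;x)=\frac{[n+1]_{p,q}}{p^n}\sum_{k=0}^\infty m_{n,k}^{(p,q)}(x)\,(pq)^{-k}\int_0^1 b_{n,k}^{(p,q)}(qt)f(t)\,d_{p,q}t,\quad 0\le x<1,$$ and $\widetilde{M}_{n,k}^{(p,q)}(f;1)=f(1)$.
   Formalization: The (p,q)-integral over [0,1] evaluates f at points such as 1/p > 1 when p < 1, so the operator is undefined for f given only on [0,1]; f is taken to be any continuous function on the whole real line (any continuous extension of f in C[0,1]). *)

(* Defs.v *)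
From HB Require Import structures.
From mathcomp Require Import all_boot all_order all_algebra.
From mathcomp Require Import all_classical all_reals all_analysis.
Set Implicit Arguments. Unset Strict Implicit. Unset Printing Implicit Defensive.
Import Order.TTheory GRing.Theory Num.Theory.
Import numFieldNormedType.Exports.
Local Open Scope classical_set_scope.
Local Open Scope ring_scope.

Section PQ.
Variable R : realType.

Definition density_zero (S : nat -> Prop) : Prop :=
  (fun N : nat => (N%:R)^-1 * (\sum_(1 <= j < N.+1) (if `[< S j >] then 1 else 0) : R))
    @ \oo --> (0 : R).

Definition st_lim (x : nat -> R) (L : R) : Prop :=
  forall eps : R, 0 < eps -> density_zero (fun n => eps <= `|x n - L|).

Definition pq_int (p q : R) (n : nat) : R := (p ^+ n - q ^+ n) / (p - q).
Definition pq_fact (p q : R) (n : nat) : R := \prod_(1 <= i < n.+1) pq_int p q i.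
Definition pq_binom (p q : R) (n k : nat) : R :=
  pq_fact p q n / (pq_fact p q k * pq_fact p q (n - k)).
Definition pq_pow (p q x y : R) (n : nat) : R :=
  \prod_(j < n) (p ^+ j * x + q ^+ j * y).

Definition rsum (u : nat -> R) : R := limn (series u).

Definition pq_integral (p q a : R) (f : R -> R) : R :=
  (p - q) * a * rsum (fun j => q ^+ j / p ^+ j.+1 * f (q ^+ j / p ^+ j.+1 * a)).

Definition m_nk (p q : R) (n k : nat) (x : R) : R :=
  (p ^+ (k * n + (n * n.+1)./2))^-1 * pq_binom p q (n + k) k * x ^+ k
  * pq_pow p q 1 (- x) n.+1.

(* b_{n,k}^{(p,q)}(q t); the exponent k(n-1)+n(n-1)/2 is an integer *)
Definition b_nk (p q : R) (n k : nat) (t : R) : R :=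
  (p ^ (k%:Z * (n%:Z - 1) + ((n * n.-1)./2)%:Z))^-1 * pq_binom p q (n + k.+1) k
  * (q * t) ^+ k * pq_pow p q 1 (- (q * t)) n.

Definition Mtilde (p q : R) (n : nat) (f : R -> R) (x : R) : R :=
  if x == 1 then f 1 else
  pq_int p q n.+1 / p ^+ n *
  rsum (fun k => m_nk p q n k x * (p * q) ^- k *
                pq_integral p q 1 (fun t => b_nk p q n k t * f t)).

Definition supnorm01 (g : R -> R) : R := sup [set `|g x| | x in `[0, 1]].

End PQ.

(* Main.v *)
(** With r = q / p all powers of p cancel: the operator at f is the average of
    f (r^j / p) against the r-Meyer-Koenig-Zeller weights m_{n,k}(x) followed by
    r-beta weights in j, both nonnegative of total mass 1 (q-binomial theorem and
    q-beta integral).  Since E_k[s] = [k+1]/[n+k+2] and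
    E_k[s^2] = [k+1][k+2]/([n+k+2][n+k+3]), comparison with the exact sums
    sum m_k [k]/[n+k] = x and sum m_k [k][k-1]/([n+k][n+k-1]) = x^2 bounds the
    second moment about x by 8/[n]_r.  A Chebyshev estimate together with the
    uniform continuity of f makes the error small uniformly in x as soon as n is
    large and q is close to 1, which holds off a set of density zero. *)
Require Import Defs.
From mathcomp Require Import all_boot all_order all_algebra.
From mathcomp Require Import all_classical all_reals all_analysis.
From mathcomp Require Import zify ring lra.
Import Order.TTheory GRing.Theory Num.Theory.
Import numFieldNormedType.Exports.
Local Open Scope classical_set_scope.
Local Open Scope ring_scope.

(** * Convergent real series *)

Section Series.
Context {R : realType}.
Implicit Types (u v : nat -> R) (l y z : R).

(** [rsum] has a value even for a divergent series; this relation carries convergence along with the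
    value. *)
Definition has_sum u l := series u @ \oo --> l.

Lemma has_sum_rsum {u l} : has_sum u l -> rsum u = l.
Proof. by move=> h; apply: cvg_lim. Qed.

Lemma has_sum_ext {u v l} : (forall k, u k = v k) -> has_sum u l -> has_sum v l.
Proof. by move=> /funext ->. Qed.

Lemma has_sumD {u v l l'} :
  has_sum u l -> has_sum v l' -> has_sum (fun k => u k + v k) (l + l').
Proof.
move=> hu hv; rewrite /has_sum.
have -> : (fun k => u k + v k) = u + v by [].
by rewrite seriesD; apply: cvgD.
Qed.

Lemma has_sumZ c {u l} : has_sum u l -> has_sum (fun k => c * u k) (c * l).
Proof.
move=> hu; rewrite /has_sum.
have -> : (fun k => c * u k) = c *: u by [].
by rewrite seriesZ; apply: cvgM (cvg_cst _) hu.
Qed.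

Lemma has_sum_shift {u l} :
  u 0%N = 0 -> has_sum (fun k => u k.+1) l -> has_sum u l.
Proof.
move=> u0 h; rewrite /has_sum -cvg_shiftS.
suff -> : (fun n => series u n.+1) = series (fun k => u k.+1) by [].
by apply/funext => n; rewrite /series /= big_nat_recl //= u0 add0r.
Qed.

(** Domination gives existence of the sum together with its bound, as needed for the series that
    involve an arbitrary [f]. *)
Lemma has_sum_norm_le {u v l} : (forall k, `|u k| <= v k) -> has_sum v l ->
  exists2 l', has_sum u l' & `|l'| <= l.
Proof.
move=> uv hv.
have cv : cvgn (series v) by apply/cvg_ex; exists l.
have cn : cvgn [normed series u].
  apply: (@series_le_cvg _ _ v) => // n; first by rewrite normr_ge0.
  exact: le_trans (normr_ge0 _) (uv n).
exists (limn (series u)); first exact: normed_cvg.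
apply: (le_trans (lim_series_norm cn)).
rewrite -(has_sum_rsum hv); exact: lim_series_le.
Qed.

Lemma has_sum_geometric z : 0 <= z < 1 -> has_sum (fun k => z ^+ k) (1 - z)^-1.
Proof.
move=> /andP[z0 z1]; rewrite -[(1 - z)^-1]mul1r.
have z1' : `|z| < 1 by rewrite ger0_norm.
apply: has_sum_ext (cvg_geometric_series (a := 1) z1') => k.
by rewrite /= mul1r.
Qed.

(* Multiplication of a generating function by the geometric series of ratio [y]. *)
Lemma has_sum_geometric_conv {u v l y} : 0 <= y < 1 ->
  (forall k, 0 <= u k) -> has_sum u l ->
  v 0%N = u 0%N -> (forall k, v k.+1 = u k.+1 + y * v k) ->
  has_sum v (l / (1 - y)).
Proof.
move=> /andP[y0 y1] u0 hu v0 vS.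
have v_ge0 k : 0 <= v k.
  by elim: k => [|k IH]; rewrite ?v0 ?vS // addr_ge0 // mulr_ge0.
have VE n : series v n.+1 = series u n.+1 + y * series v n.
  elim: n => [|n IH].
    by rewrite !seriesSr /series /= !big_geq // mulr0 addr0 v0.
  by rewrite (seriesSr v n.+1) vS (seriesSr u n.+1) {1}IH (seriesSr v n); ring.
have mono (w : nat -> R) : (forall k, 0 <= w k) ->
    {homo series w : n m / (n <= m)%N >-> n <= m}.
  move=> w0; apply/nondecreasing_seqP => n.
  by rewrite seriesSr lerDl.
have cu : cvgn (series u) by apply/cvg_ex; exists l.
have ul n : series u n <= l.
  by rewrite -(has_sum_rsum hu); apply: nondecreasing_cvgn_le => //; apply: mono.
(* Monotonicity gives [series v n <= series v n.+1 <= l + y * series v n], which bounds the partial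
   sums by [l / (1 - y)]. *)
have cv : cvgn (series v).
  apply: nondecreasing_is_cvgn; first exact: mono.
  exists (l / (1 - y)) => _ [n _ <-].
  rewrite ler_pdivlMr ?subr_gt0 // mulrBr mulr1 lerBlDl.
  have : series v n <= series v n.+1 by apply: mono.
  rewrite VE => /le_trans; apply.
  by rewrite addrC mulrC lerD2l.
have [L hL] : exists L, has_sum v L by exists (limn (series v)).
have h1 : (fun n => series v n.+1) @ \oo --> L by rewrite cvg_shiftS.
have h2 : (fun n => series v n.+1) @ \oo --> l + y * L.
  have -> : (fun n => series v n.+1) =
      (fun n => series u n.+1) \+ (fun n => y * series v n).
    by apply/funext => n; rewrite VE.
  apply: cvgD; first by rewrite cvg_shiftS.
  exact: cvgM (cvg_cst _) hL.
have LE : L = l + y * L by apply: cvg_unique h1 h2.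
suff -> : l / (1 - y) = L by [].
have y1' : 1 - y != 0 by rewrite subr_eq0 gt_eqF.
apply: (mulIf y1'); rewrite divfK // mulrBr mulr1 mulrC.
by apply/eqP; rewrite eq_sym subr_eq -LE.
Qed.

End Series.

(** * Calculus of r-integers: binomial theorem, beta sums, moments of the weights *)

Section QCalculus.
Context {R : realType}.
Variable r : R.
Hypotheses (r0 : 0 < r) (r1 : r < 1).
Implicit Types (x y : R) (m n k j : nat).

Local Notation "`[ n ]" := (pq_int 1 r n).
Local Notation "`[ n ]!" := (pq_fact 1 r n).

Let subr_neq0 : 1 - r != 0. Proof. by rewrite subr_eq0 gt_eqF. Qed.

Lemma qint0 : `[0] = 0.
Proof. by rewrite /pq_int !expr0 subrr mul0r. Qed.

Lemma qintD m n : `[m + n] = `[m] + r ^+ m * `[n].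
Proof. by rewrite /pq_int !expr1n exprD; field. Qed.

Lemma qint1 : `[1] = 1.
Proof. by rewrite /pq_int !expr1 divff. Qed.

Lemma qintS n : `[n.+1] = `[n] + r ^+ n.
Proof. by rewrite -addn1 qintD qint1 mulr1. Qed.

Lemma qintS_le n : `[n.+1] <= `[n] + 1.
Proof. by rewrite qintS lerD2l exprn_ile1 // ltW. Qed.

Lemma qint_ge0 n : 0 <= `[n].
Proof.
elim: n => [|n IH]; first by rewrite qint0.
by rewrite qintS addr_ge0 // exprn_ge0 // ltW.
Qed.

Lemma qint_gt0 n : 0 < `[n.+1].
Proof. by rewrite qintS ltr_wpDl ?qint_ge0 // exprn_gt0. Qed.

Lemma qint_neq0 n : `[n.+1] != 0.
Proof. by rewrite gt_eqF ?qint_gt0. Qed.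

Lemma qint_le m n : (m <= n)%N -> `[m] <= `[n].
Proof.
by move=> /subnKC <-; rewrite qintD lerDl mulr_ge0 ?qint_ge0 ?exprn_ge0 // ltW.
Qed.

(** [m] is a sum of m powers of r, each at least r^m. This makes [n] large once n is large and r is
    close to 1. *)
Lemma qint_ge m n : (m <= n)%N -> m%:R * r ^+ m <= `[n].
Proof.
move=> mn; apply: le_trans (qint_le _ _ mn); rewrite /pq_int expr1n.
elim: m {mn} => [|m IH]; first by rewrite mul0r expr0 subrr mul0r.
have -> : (1 - r ^+ m.+1) / (1 - r) = (1 - r ^+ m) / (1 - r) + r ^+ m.
  by rewrite exprS; field.
rewrite -natr1 mulrDl mul1r lerD //; last by rewrite ler_wiXn2l ?ltW.
by apply: le_trans IH; rewrite ler_wpM2l // ler_wiXn2l ?ltW.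
Qed.

Lemma qfact0 : `[0]! = 1.
Proof. by rewrite /pq_fact big_geq. Qed.

Lemma qfactS n : `[n.+1]! = `[n]! * `[n.+1].
Proof. by rewrite /pq_fact big_nat_recr. Qed.

Lemma qfact_gt0 n : 0 < `[n]!.
Proof. by elim: n => [|n IH]; rewrite ?qfact0 // qfactS mulr_gt0 ?qint_gt0. Qed.

Lemma qfact_neq0 n : `[n]! != 0.
Proof. by rewrite gt_eqF ?qfact_gt0. Qed.

Lemma qbinomE n k : pq_binom 1 r (n + k) k = `[n + k]! / (`[k]! * `[n]!).
Proof. by rewrite /pq_binom addnK. Qed.

Lemma qbinom0 n : pq_binom 1 r n 0 = 1.
Proof. by rewrite /pq_binom subn0 qfact0 mul1r divff // qfact_neq0. Qed.

Lemma qbinom_ge0 n k : 0 <= pq_binom 1 r (n + k) k.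
Proof. by rewrite qbinomE divr_ge0 // ?mulr_ge0 // ltW ?qfact_gt0. Qed.

(** Follows from the splitting [n+k+2] = [n+1] + r^(n+1) [k+1]. *)
Lemma qbinom_pascal n k : pq_binom 1 r (n.+1 + k.+1) k.+1 =
  pq_binom 1 r (n + k.+1) k.+1 + r ^+ n.+1 * pq_binom 1 r (n.+1 + k) k.
Proof.
rewrite !qbinomE [(n.+1 + k.+1)%N]addnS [(n + k.+1)%N]addnS -addSn.
rewrite [`[(n.+1 + k).+1]!]qfactS -addnS qintD !(qfactS n) !(qfactS k).
by field; rewrite ?qint_neq0 ?qfact_neq0.
Qed.

Lemma qpowS y n :
  pq_pow 1 r 1 y n.+1 = pq_pow 1 r 1 y n * (1 + r ^+ n * y).
Proof. by rewrite /pq_pow big_ord_recr /= expr1n mul1r. Qed.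

Lemma qpow_gt0 x n : x < 1 -> 0 < pq_pow 1 r 1 (- x) n.
Proof.
move=> x1; elim: n => [|n IH]; first by rewrite /pq_pow big_ord0.
rewrite qpowS mulr_gt0 // mulrN subr_gt0.
have rn : r ^+ n <= 1 by rewrite exprn_ile1 // ltW.
have rn0 : 0 < r ^+ n by rewrite exprn_gt0.
have [x0|x0] := lerP 0 x; last by apply: lt_trans ltr01; rewrite pmulr_rlt0.
by apply: le_lt_trans x1; rewrite ler_piMl.
Qed.

Lemma m_nkE n k x : m_nk 1 r n k x =
  pq_binom 1 r (n + k) k * x ^+ k * pq_pow 1 r 1 (- x) n.+1.
Proof. by rewrite /m_nk expr1n invr1 mul1r. Qed.

Lemma m_nk_ge0 n k x : 0 <= x < 1 -> 0 <= m_nk 1 r n k x.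
Proof.
move=> /andP[x0 x1]; rewrite m_nkE; apply: mulr_ge0; last by rewrite ltW // qpow_gt0.
by apply: mulr_ge0; rewrite ?qbinom_ge0 ?exprn_ge0.
Qed.

(** Induction on n: by the Pascal rule, raising n multiplies the generating function by the
    geometric series of ratio r^(n+1) x, the inverse of the new factor. *)
Lemma has_sum_qbinom n x : 0 <= x < 1 ->
  has_sum (fun k => pq_binom 1 r (n + k) k * x ^+ k)
    (pq_pow 1 r 1 (- x) n.+1)^-1.
Proof.
move=> /andP[x0 x1]; elim: n => [|n IH].
  rewrite qpowS {1}/pq_pow big_ord0 expr0 !mul1r.
  apply: has_sum_ext (has_sum_geometric x _); last by rewrite x0.
  by move=> k; rewrite qbinomE add0n qfact0 mulr1 divff ?mul1r // qfact_neq0.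
rewrite qpowS invfM mulrN.
apply: (has_sum_geometric_conv _ _ IH) => [|k||k].
- rewrite mulr_ge0 ?exprn_ge0 ?(ltW r0) //=.
  by apply: le_lt_trans x1; rewrite ler_piMl // exprn_ile1 // ltW.
- by apply: mulr_ge0; rewrite ?qbinom_ge0 ?exprn_ge0.
- by rewrite !qbinom0.
- by rewrite qbinom_pascal [x ^+ _]exprS; ring.
Qed.

Lemma has_sum_m_nk n x : 0 <= x < 1 -> has_sum (fun k => m_nk 1 r n k x) 1.
Proof.
move=> xP; have /andP[x0 x1] := xP.
have := has_sumZ (pq_pow 1 r 1 (- x) n.+1) (has_sum_qbinom n _ xP).
rewrite divff ?gt_eqF ?qpow_gt0 //; apply: has_sum_ext => k.
by rewrite m_nkE mulrC.
Qed.

(** Absorption identity for r-binomials: the ratio lowers k by one, so the first moment becomes x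
    times the total mass. *)
Lemma m_nkS n k x :
  m_nk 1 r n k.+1 x * (`[k.+1] / `[n + k.+1]) = x * m_nk 1 r n k x.
Proof.
rewrite !m_nkE !qbinomE addnS !qfactS exprS; field.
by rewrite !qint_neq0 !qfact_neq0.
Qed.

Lemma has_sum_m_nk_mean n x : 0 <= x < 1 ->
  has_sum (fun k => m_nk 1 r n k x * (`[k] / `[n + k])) x.
Proof.
move=> xP; apply: has_sum_shift; first by rewrite qint0 mul0r mulr0.
apply: (@has_sum_ext _ (fun k => x * m_nk 1 r n k x)) => [k|].
  by rewrite m_nkS.
by rewrite -[X in has_sum _ X]mulr1; apply/has_sumZ/has_sum_m_nk.
Qed.

(** Absorption applied twice; at k = 0 the truncated [k.-1] is harmless because the factor [0]
    vanishes. *)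
Lemma has_sum_m_nk_sqr n x : 0 <= x < 1 ->
  has_sum (fun k => m_nk 1 r n k x *
    (`[k] / `[n + k] * (`[k.-1] / `[n + k.-1]))) (x ^+ 2).
Proof.
move=> xP; apply: has_sum_shift; first by rewrite qint0 !mul0r mulr0.
apply: (@has_sum_ext _ (fun k => x * (m_nk 1 r n k x * (`[k] / `[n + k])))).
  by move=> k; rewrite [RHS]mulrA m_nkS -mulrA.
by rewrite expr2; apply/has_sumZ/has_sum_m_nk_mean.
Qed.

(** The r-beta integral of t^k times the r-power of 1 - r t, as a Jackson sum at t = r^j. In the
    induction the new factor 1 - r^(n+1) t yields the sums for k and k+1. *)
Lemma has_sum_qbeta n k :
  has_sum (fun j => (1 - r) * r ^+ j * (r ^+ j) ^+ k *
                    pq_pow 1 r 1 (- r ^+ j.+1) n)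
    (`[k]! * `[n]! / `[(n + k).+1]!).
Proof.
elim: n k => [|n IH] k.
  have rk : 0 <= r ^+ k.+1 < 1.
    by rewrite exprn_ge0 ?ltW // exprn_ilt1 // ltW.
  have := has_sumZ (1 - r) (has_sum_geometric _ rk).
  have -> : (1 - r) / (1 - r ^+ k.+1) = `[k]! * `[0]! / `[(0 + k).+1]!.
    rewrite add0n qfact0 qfactS /pq_int expr1n; field.
    rewrite qfact_neq0 subr_neq0 subr_eq0 gt_eqF //.
    by case/andP: rk.
  apply: has_sum_ext => j; rewrite /pq_pow big_ord0 mulr1 -mulrA; congr (_ * _).
  by rewrite -exprS -!exprM mulnC.
have := has_sumD (IH k) (has_sumZ (- r ^+ n.+1) (IH k.+1)).
have -> : `[k]! * `[n]! / `[(n + k).+1]! +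
    - r ^+ n.+1 * (`[k.+1]! * `[n]! / `[(n + k.+1).+1]!) =
    `[k]! * `[n.+1]! / `[(n.+1 + k).+1]!.
  have : `[(n.+1 + k).+1] = `[n.+1] + r ^+ n.+1 * `[k.+1].
    by rewrite -addnS qintD.
  rewrite addnS addSn (qfactS (n + k).+1) (qfactS n) (qfactS k) => E.
  have -> : `[n.+1] = `[(n + k).+2] - r ^+ n.+1 * `[k.+1] by rewrite E addrK.
  by field; rewrite qint_neq0 qfact_neq0.
by apply: has_sum_ext => j; rewrite qpowS !exprS; ring.
Qed.

(* The [k]-th weights of the operator on the nodes [r ^+ j / p], after the
   powers of [p] cancel. *)
Definition durrmeyer_weight n k j : R :=
  `[(n + k).+1]! / (`[k]! * `[n]!) *
  ((1 - r) * r ^+ j * (r ^+ j) ^+ k * pq_pow 1 r 1 (- r ^+ j.+1) n).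

Lemma durrmeyer_weight_ge0 n k j : 0 <= durrmeyer_weight n k j.
Proof.
apply: mulr_ge0; first by rewrite divr_ge0 ?mulr_ge0 // ltW ?qfact_gt0.
apply: mulr_ge0; last by rewrite ltW // qpow_gt0 // exprn_ilt1 // ltW.
by rewrite !mulr_ge0 ?exprn_ge0 ?subr_ge0 ?(ltW r0) ?(ltW r1).
Qed.

Lemma has_sum_durrmeyer_weight n k : has_sum (durrmeyer_weight n k) 1.
Proof.
have := has_sumZ (`[(n + k).+1]! / (`[k]! * `[n]!)) (has_sum_qbeta n k).
rewrite [X in has_sum _ X](_ : _ = 1) //.
by field; rewrite !qfact_neq0.
Qed.

(** An extra factor r^j raises k by one in the r-beta sum; the mean is the ratio of the two
    values. *)
Lemma has_sum_durrmeyer_weight_mean n k :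
  has_sum (fun j => durrmeyer_weight n k j * r ^+ j) (`[k.+1] / `[n + k.+2]).
Proof.
have := has_sumZ (`[(n + k).+1]! / (`[k]! * `[n]!)) (has_sum_qbeta n k.+1).
rewrite [X in has_sum _ X](_ : _ = `[k.+1] / `[n + k.+2]); last first.
  rewrite !addnS !qfactS; field.
  by rewrite !qint_neq0 !qfact_neq0.
by apply: has_sum_ext => j; rewrite /durrmeyer_weight [_ ^+ k.+1]exprS; ring.
Qed.

Lemma has_sum_durrmeyer_weight_sqr n k :
  has_sum (fun j => durrmeyer_weight n k j * (r ^+ j) ^+ 2)
    (`[k.+1] / `[n + k.+2] * (`[k.+2] / `[n + k.+3])).
Proof.
have := has_sumZ (`[(n + k).+1]! / (`[k]! * `[n]!)) (has_sum_qbeta n k.+2).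
rewrite [X in has_sum _ X](_ : _ =
    `[k.+1] / `[n + k.+2] * (`[k.+2] / `[n + k.+3])); last first.
  rewrite !addnS !qfactS; field.
  by rewrite !qint_neq0 !qfact_neq0.
apply: has_sum_ext => j.
by rewrite /durrmeyer_weight [_ ^+ k.+2]exprS [_ ^+ k.+1]exprS; ring.
Qed.

End QCalculus.

(** * Reduction from (p, q) to the single ratio r = q / p *)

Section Scaling.
Context {R : realType}.
Variables p q : R.
Hypotheses (q0 : 0 < q) (qp : q < p).

Let p0 : 0 < p. Proof. exact: lt_trans q0 qp. Qed.
Let p_neq0 : p != 0. Proof. by rewrite gt_eqF. Qed.
Let q_neq0 : q != 0. Proof. by rewrite gt_eqF. Qed.
Let pq_neq0 : p - q != 0. Proof. by rewrite subr_eq0 gt_eqF. Qed.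
Let r0 : 0 < q / p. Proof. by rewrite divr_gt0. Qed.
Let r1 : q / p < 1. Proof. by rewrite ltr_pdivrMr ?mul1r. Qed.

Lemma pq_int_scale n : pq_int p q n.+1 = p ^+ n * pq_int 1 (q / p) n.+1.
Proof.
rewrite /pq_int expr1n expr_div_n [p ^+ n.+1]exprS; field.
by rewrite p_neq0 pq_neq0 expf_neq0.
Qed.

(** The i-th factor contributes p^(i-1), and these exponents add up to C(n, 2). *)
Lemma pq_fact_scale n : pq_fact p q n = p ^+ 'C(n, 2) * pq_fact 1 (q / p) n.
Proof.
elim: n => [|n IH]; first by rewrite /pq_fact !big_geq // bin0n mulr1.
by rewrite !qfactS {1}/pq_fact big_nat_recr //= -/(pq_fact p q n) IH
  pq_int_scale binS bin1 exprD; ring.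
Qed.

Lemma pq_binom_scale n k :
  pq_binom p q (n + k) k = p ^+ (k * n) * pq_binom 1 (q / p) (n + k) k.
Proof.
rewrite /pq_binom addnK !pq_fact_scale.
have -> : 'C(n + k, 2) = (k * n + 'C(k, 2) + 'C(n, 2))%N.
  elim: n => [|n IH]; first by rewrite muln0 bin0n addn0.
  by rewrite addSn !binS !bin1 IH mulnS; lia.
rewrite !exprD; field.
by rewrite !qfact_neq0 // !expf_neq0.
Qed.

Lemma pq_pow_scale y n :
  pq_pow p q 1 y n = p ^+ 'C(n, 2) * pq_pow 1 (q / p) 1 y n.
Proof.
elim: n => [|n IH]; first by rewrite /pq_pow !big_ord0 mulr1.
rewrite qpowS {1}/pq_pow big_ord_recr /= -/(pq_pow p q 1 y n) IH.
rewrite binS bin1 exprD expr_div_n; field.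
by rewrite expf_neq0.
Qed.

Lemma m_nk_scale n k x : m_nk p q n k x = m_nk 1 (q / p) n k x.
Proof.
rewrite m_nkE /m_nk pq_binom_scale pq_pow_scale.
rewrite bin2 /= mulnC [(n.+1 * n)%N]mulnC exprD; field.
by rewrite !expf_neq0.
Qed.

(** At the node, q t = r^(j+1). Binomial, product and prefactor leave p^(2k), which combines with
    the r^k from r^((j+1)k) into (p q)^k; the operator divides by exactly this. *)
Lemma b_nk_node n k j :
  b_nk p q n k (q ^+ j / p ^+ j.+1) =
  (p * q) ^+ k * pq_binom 1 (q / p) (n.+1 + k) k * ((q / p) ^+ j) ^+ k *
  pq_pow 1 (q / p) 1 (- (q / p) ^+ j.+1) n.
Proof.
rewrite /b_nk addnS -addSn pq_binom_scale pq_pow_scale -bin2.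
have -> : q * (q ^+ j / p ^+ j.+1) = (q / p) ^+ j.+1.
  by rewrite expr_div_n [q ^+ j.+1]exprS mulrA.
(* The integer exponent can be negative when n = 0; writing k(n-1) as k(n+1) - 2k leaves only
   natural powers. *)
have -> : p ^ (k%:Z * (n%:Z - 1) + 'C(n, 2)%:Z) =
    p ^+ (k * n.+1) * p ^+ 'C(n, 2) / (p ^+ k * p ^+ k).
  rewrite -!exprD; apply: (canRL (mulfK _)); first by rewrite expf_neq0.
  rewrite [p ^+ (k + k)]exprnP [RHS]exprnP -expfzDr //; congr (_ ^ _).
  by lia.
have -> : ((q / p) ^+ j.+1) ^+ k = q ^+ k / p ^+ k * ((q / p) ^+ j) ^+ k.
  by rewrite exprS exprMn expr_div_n.
rewrite [(p * q) ^+ k]exprMn.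
move: (((q / p) ^+ j) ^+ k) (pq_pow _ _ _ _ _) (pq_binom _ _ _ _) => y z w.
have := expf_neq0 (k * n.+1) p_neq0; move: (p ^+ (k * n.+1)) => P P0.
have := expf_neq0 'C(n, 2) p_neq0; move: (p ^+ 'C(n, 2)) => C C0.
by field; rewrite P0 C0 expf_neq0.
Qed.

(* [pq_int p q n.+1 / p ^+ n] is absorbed in the normalisation of the weights. *)
Lemma Mtilde_has_sum n (f : R -> R) x (G : nat -> R) L : x != 1 ->
  (forall k, has_sum (fun j => durrmeyer_weight (q / p) n k j *
                               f ((q / p) ^+ j / p)) (G k)) ->
  has_sum (fun k => m_nk 1 (q / p) n k x * G k) L ->
  Mtilde p q n f x = L.
Proof.
move=> x1 hG hL; rewrite /Mtilde (negbTE x1) pq_int_scale.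
set N := pq_int 1 (q / p) n.+1.
have N0 : N != 0 by rewrite qint_neq0.
(* The binomial in [b_nk] has [n+1]! in its denominator where the weight has [n]!, whence the
   division by [N]. *)
have intE k : pq_integral p q 1 (fun t => b_nk p q n k t * f t) =
    (p * q) ^+ k / N * G k.
  rewrite /pq_integral mulr1.
  have /has_sum_rsum E := has_sumZ ((p * q) ^+ k / N / (p - q)) (hG k).
  rewrite [rsum _](_ : _ = (p * q) ^+ k / N / (p - q) * G k); last first.
    rewrite -E; congr rsum; apply/funext => j.
    rewrite mulr1 b_nk_node /durrmeyer_weight qbinomE addSn !qfactS -/N.
    have -> : q ^+ j / p ^+ j.+1 = (q / p) ^+ j / p.
      by rewrite expr_div_n exprSr invfM mulrA.
    field.
    by rewrite !qfact_neq0 // N0 p_neq0 pq_neq0.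
  by field; rewrite N0 pq_neq0.
have := has_sum_rsum (has_sumZ N^-1 hL).
rewrite [rsum _](_ : _ = rsum (fun k => m_nk p q n k x * (p * q) ^- k *
    pq_integral p q 1 (fun t => b_nk p q n k t * f t))); last first.
  congr rsum; apply/funext => k; rewrite intE m_nk_scale; field.
  by rewrite N0 expf_neq0 ?mulf_neq0.
by move=> ->; field; rewrite N0 expf_neq0.
Qed.

End Scaling.

(** * Comparison of the inner moments with the exactly summable ratios *)

Section Variance.
Context {R : realType}.
Variable r : R.
Hypotheses (r0 : 0 < r) (r1 : r < 1).

Local Notation "`[ n ]" := (pq_int 1 r n).

(** A larger denominator only lowers the ratio, and the surplus c of the numerator is divided by S
    >= N. *)
Let ratio_le (N S T K K' c : R) : 0 < N -> N <= S -> S <= T ->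
  0 <= K -> 0 <= c -> K' <= K + c -> K' / T <= K / S + c / N.
Proof.
move=> N0 NS ST K0 c0 KK.
have S0 : 0 < S by lra.
apply: (@le_trans _ _ ((K + c) / T)); first by rewrite ler_pM2r // invr_gt0; lra.
apply: (@le_trans _ _ ((K + c) / S)).
  by apply: ler_wpM2l; [lra|rewrite lef_pV2 ?posrE //; lra].
rewrite mulrDl lerD2l; apply: ler_wpM2l => //.
by rewrite lef_pV2 ?posrE //; lra.
Qed.

Lemma qratio_le1 n k : (0 < n)%N -> `[k] / `[n + k] <= 1.
Proof.
case: n => // n _; rewrite addSn ler_pdivrMr ?qint_gt0 // mul1r.
by rewrite qint_le // -addSn leq_addl.
Qed.

(** Raising the denominator from S to T <= S + 2 costs (K/S)(T-S)/T <= 2/N. A lower bound suffices,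
    as the mean enters the second moment about x with coefficient -2x. *)
Lemma weight_mean_ge n k : (0 < n)%N ->
  `[k] / `[n + k] - 2 / `[n] <= `[k.+1] / `[n + k.+2].
Proof.
case: n => // n _.
have N0 := qint_gt0 _ r0 r1 n.
have NS : `[n.+1] <= `[n.+1 + k] by rewrite qint_le // leq_addr.
have ST : `[n.+1 + k] <= `[n.+1 + k.+2] by rewrite qint_le // leq_add2l; lia.
have TS : `[n.+1 + k.+2] <= `[n.+1 + k] + 2.
  rewrite !addnS; have := qintS_le _ r0 r1 (n.+1 + k).+1.
  have := qintS_le _ r0 r1 (n.+1 + k); lra.
have c1 := qratio_le1 n.+1 k isT.
have KK : `[k] <= `[k.+1] by rewrite qint_le.
have K0 := qint_ge0 _ r0 r1 k.
move: N0 NS ST TS c1 KK K0.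
move: `[n.+1] `[n.+1 + k] `[n.+1 + k.+2] `[k.+1] `[k].
move=> N S T K' K N0 NS ST TS c1 KK K0.
have S0 : 0 < S by lra.
have T0 : 0 < T by lra.
apply: (@le_trans _ _ (K / T)); last by rewrite ler_pM2r // invr_gt0.
rewrite lerBlDr -lerBlDl.
have -> : K / S - K / T = K / S * ((T - S) / T).
  by field; rewrite !gt_eqF.
apply: (@le_trans _ _ ((T - S) / T)).
  by rewrite ler_piMl // divr_ge0 ?subr_ge0 // ltW.
apply: (@le_trans _ _ (2 / T)); first by rewrite ler_pM2r ?invr_gt0 //; lra.
by rewrite ler_pM2l // lef_pV2 ?posrE //; lra.
Qed.

Lemma weight_sqr_le n k : (0 < n)%N ->
  `[k.+1] / `[n + k.+2] * (`[k.+2] / `[n + k.+3]) <=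
  `[k] / `[n + k] * (`[k.-1] / `[n + k.-1]) + 4 / `[n].
Proof.
move=> n0.
have N0 : 0 < `[n] by case: n n0 => // n _; rewrite qint_gt0.
have h1 : `[k.+1] / `[n + k.+2] <= `[k] / `[n + k] + 1 / `[n].
  by apply: ratio_le; rewrite ?qint_ge0 ?qintS_le ?qint_le // ?leq_addr // leq_add2l; lia.
have h2 : `[k.+2] / `[n + k.+3] <= `[k.-1] / `[n + k.-1] + 3 / `[n].
  apply: ratio_le; rewrite ?qint_ge0 ?qint_le // ?leq_addr //.
    by rewrite leq_add2l; lia.
  have := qintS_le _ r0 r1 k.+1; have := qintS_le _ r0 r1 k.
  (* At k = 0 the predecessor is 0 again and the gap is only 2. *)
  case: k {h1} => [|k] /=; first lra.
  have := qintS_le _ r0 r1 k; lra.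
have c1 := qratio_le1 n k n0.
have c0 : 0 <= `[k] / `[n + k] by rewrite divr_ge0 // qint_ge0.
have b0 : 0 <= `[k.+2] / `[n + k.+3] by rewrite divr_ge0 // qint_ge0.
have b1 : `[k.+2] / `[n + k.+3] <= 1.
  by rewrite -addSnnS; apply: qratio_le1.
have e0 : 0 < `[n]^-1 by rewrite invr_gt0.
move: h1 h2 c1 c0 b0 b1 e0.
move: (`[k.+1] / _) (`[k.+2] / _) (`[k] / _) (`[k.-1] / _) (`[n]^-1).
move=> A B c d e h1 h2 c1 c0 b0 b1 e0.
(* Since B <= 1 and c <= 1: (c + e) B <= c (d + 3e) + e <= c d + 4e. *)
apply: (@le_trans _ _ ((c + 1 * e) * B)); first exact: ler_wpM2r.
nra.
Qed.

End Variance.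

(** * Pointwise Chebyshev estimate *)

Section Estimate.
Context {R : realType}.

(** The operator samples [f] at s / p with s = r^j, whereas the moments are those of s; hence the
    mixed form of the hypothesis. *)
Lemma Mtilde_dist_le (p q : R) n (f : R -> R) x eps K :
  0 < q -> q < p -> (0 < n)%N -> 0 <= x < 1 -> 0 <= eps -> 0 <= K ->
  (forall s, 0 <= s <= 1 -> `|f (s / p) - f x| <= eps + K * (s - x) ^+ 2) ->
  `|Mtilde p q n f x - f x| <= eps + K * (8 / pq_int 1 (q / p) n).
Proof.
move=> q0 qp n0 xP eps0 K0 hf.
have p0 : 0 < p by apply: lt_trans qp.
have r0 : 0 < q / p by rewrite divr_gt0.
have r1 : q / p < 1 by rewrite ltr_pdivrMr ?mul1r.
have /andP[x0 x1] := xP.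
set r := q / p in r0 r1 *.
pose A k := pq_int 1 r k.+1 / pq_int 1 r (n + k.+2).
pose B k := A k * (pq_int 1 r k.+2 / pq_int 1 r (n + k.+3)).
(* [D k] is the inner average of f - f(x); its bound contains the second moment of the k-th weights
   about x. *)
have [D hD Dle] : exists2 D : nat -> R,
    forall k, has_sum (fun j => durrmeyer_weight r n k j *
      (f (r ^+ j / p) - f x)) (D k) &
    forall k, `|D k| <= eps + K * (B k - 2 * x * A k + x ^+ 2).
  suff /choice[D hD] : forall k, exists d, has_sum (fun j =>
      durrmeyer_weight r n k j * (f (r ^+ j / p) - f x)) d /\
      `|d| <= eps + K * (B k - 2 * x * A k + x ^+ 2).
    by exists D => k; case: (hD k).
  move=> k.
  have hv := has_sumD (has_sumD
    (has_sumZ (eps + K * x ^+ 2) (has_sum_durrmeyer_weight r r0 r1 n k))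
    (has_sumZ (- (2 * K * x)) (has_sum_durrmeyer_weight_mean r r0 r1 n k)))
    (has_sumZ K (has_sum_durrmeyer_weight_sqr r r0 r1 n k)).
  have [|d hd dle] := has_sum_norm_le (u := fun j =>
      durrmeyer_weight r n k j * (f (r ^+ j / p) - f x)) _ hv.
    move=> j; have w0 := durrmeyer_weight_ge0 r r0 r1 n k j.
    rewrite normrM (ger0_norm w0).
    apply: (@le_trans _ _ (durrmeyer_weight r n k j *
        (eps + K * (r ^+ j - x) ^+ 2))); last by lra.
    by apply: ler_wpM2l => //; apply: hf; rewrite exprn_ge0 ?exprn_ile1 ?ltW.
  exists d; split => //; apply: (le_trans dle).
  by rewrite -/(A k) -/(B k); lra.
pose N := pq_int 1 r n.
have N0 : 0 < N by rewrite /N; case: n n0 {A B D hD Dle N} => // n _; rewrite qint_gt0.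
have hm := has_sum_m_nk r r0 r1 n x xP.
(* Majorant obtained from the two ratio comparisons; the x^2 terms cancel in its sum, leaving eps +
   K (4/N + 4x/N). *)
have hv := has_sumD (has_sumD (has_sumZ (eps + K * (x ^+ 2 + 4 / N + 4 * x / N)) hm)
  (has_sumZ (- (2 * K * x)) (has_sum_m_nk_mean r r0 r1 n x xP)))
  (has_sumZ K (has_sum_m_nk_sqr r r0 r1 n x xP)).
have [|L hL Lle] := has_sum_norm_le (u := fun k => m_nk 1 r n k x * D k) _ hv.
  move=> k; have m0 := m_nk_ge0 r r0 r1 n k x xP.
  rewrite normrM (ger0_norm m0).
  have /(ler_wpM2l m0)/le_trans := Dle k; apply.
  have mA := weight_mean_ge r r0 r1 n k n0.
  have mB := weight_sqr_le r r0 r1 n k n0.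
  rewrite -/(A k) -/N in mA; rewrite -/(A k) -/(B k) -/N in mB.
  move: mA mB; move: (pq_int 1 r k / _) (pq_int 1 r k.-1 / _) => c d mA mB.
  apply: (@le_trans _ _ (m_nk 1 r n k x * (eps + K * (c * d + 4 / N
      - 2 * x * (c - 2 / N) + x ^+ 2)))); last by lra.
  apply: ler_wpM2l => //; rewrite lerD2l; apply: ler_wpM2l => //.
  rewrite lerD2r; apply: lerB => //; apply: ler_wpM2l => //.
  by rewrite mulr_ge0.
have -> : Mtilde p q n f x = L + f x.
  apply: (@Mtilde_has_sum _ _ _ q0 qp _ _ _ (fun k => D k + f x)).
  - by rewrite lt_eqF.
  - move=> k.
    have := has_sumD (hD k) (has_sumZ (f x) (has_sum_durrmeyer_weight r r0 r1 n k)).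
    by rewrite mulr1; apply: has_sum_ext => j; rewrite -/r; ring.
  - have := has_sumD hL (has_sumZ (f x) hm).
    by rewrite mulr1; apply: has_sum_ext => k; ring.
rewrite addrK; apply: (le_trans Lle); rewrite -/N.
have e0 : 0 < N^-1 by rewrite invr_gt0.
have : K * (x / N) <= K * (1 / N).
  by apply: ler_wpM2l => //; apply: ler_wpM2r; rewrite ltW.
by move: (N^-1) => e; lra.
Qed.

End Estimate.

(** * Uniformity in x, and sets of density zero *)

Section Uniform.
Context {R : realType}.

(** Only x is confined to the segment: the nodes s / p, in the role of y, may exceed 1. *)
Lemma continuous_unif_segment (f : R -> R) (a b e : R) : continuous f ->
  0 < e -> exists2 d, 0 < d &
    forall x y, a <= x <= b -> `|x - y| < d -> `|f x - f y| < e.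
Proof.
move=> cf e0.
have /compact_near_coveringP cvr := @segment_compact R a b.
have : \forall d \near 0^'+, `[a, b] `<=`
    [set x | forall y, `|x - y| < d -> `|f x - f y| < e].
  apply: (cvr R 0^'+ (fun d x => forall y, `|x - y| < d -> `|f x - f y| < e)).
  move=> x _; have e2 : 0 < e / 2 by lra.
  have /cvgrPdist_lt/(_ _ e2)/nbhs_ballP[h /= h0 hx] := cf x.
  exists (ball x (h / 2), [set d | d < h / 2]) => /=.
    split; last by apply: nbhs_right_lt; lra.
    by apply: nbhsx_ballx; lra.
  move=> [z d] /= [xz dh] y zy.
  have := hx z; have := hx y; rewrite /ball /= in xz *.
  have xy : `|x - y| < h by have := ler_distD z x y; lra.
  have xz' : `|x - z| < h by lra.
  move=> /(_ xy) fy /(_ xz') fz.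
  have := ler_distD (f x) (f z) (f y); rewrite (distrC (f z) (f x)); lra.
move=> nd; have [d [d0 hd]] : exists d : R, 0 < d /\
    `[a, b] `<=` [set x | forall y, `|x - y| < d -> `|f x - f y| < e].
  have : \forall d \near 0^'+, 0 < d /\
      `[a, b] `<=` [set x | forall y, `|x - y| < d -> `|f x - f y| < e].
    by near=> d; split; near: d => //; exact: nbhs_right_gt.
  exact: filter_ex.
exists d => // x y xab; apply: hd.
by rewrite /= in_itv.
Unshelve. all: by end_near. Qed.

Lemma continuous_bounded_segment (f : R -> R) (a b : R) : continuous f ->
  exists2 B, 0 <= B & forall x, a <= x <= b -> `|f x| <= B.
Proof.
move=> cf.
have [ab|ba] := leP a b; last first.
  by exists 0 => // x /andP[ax xb]; have := le_trans ax xb; lra.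
have cnf : {within `[a, b], continuous (fun x => `|f x|)}.
  apply: continuous_subspaceT => x.
  exact: (continuous_comp (cf x) (@norm_continuous _ _ _)).
have [c _ hc] := EVT_max ab cnf.
by exists `|f c| => // x xab; apply: hc.
Qed.

(** Indices below N add at most N to each count, hence N / M to the mean over M terms, which tends
    to 0. *)
Lemma density_zero_eventually_sub (S T : nat -> Prop) N :
  (forall n, (N <= n)%N -> S n -> T n) ->
  density_zero R T -> density_zero R S.
Proof.
move=> ST; rewrite /density_zero => hT.
pose c (U : nat -> Prop) j := if `[< U j >] then 1 else 0 : R.
have c0 U j : 0 <= c U j by rewrite /c; case: ifP.
have cST j : c S j <= (j < N)%:R + c T j.
  rewrite /c; case: (asboolP (S j)) => Sj; last first.
    by rewrite addr_ge0 //; case: ifP.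
  have [jN|Nj] := ltnP j N; first by rewrite lerDl; case: ifP.
  by rewrite (asboolT (ST _ Nj Sj)) add0r.
have cN M : \sum_(1 <= j < M.+1) (j < N)%:R <= N%:R :> R.
  (* The bound by N alone is not inductive. *)
  suff : \sum_(1 <= j < M.+1) (j < N)%:R <= (minn M N)%:R :> R.
    by move=> /le_trans; apply; rewrite ler_nat geq_minr.
  elim: M => [|M IH]; first by rewrite big_geq.
  rewrite big_nat_recr //=; apply: le_trans (lerD IH (lexx _)) _.
  by rewrite -natrD ler_nat; lia.
apply: (@squeeze_cvgr _ _ _ _ (fun=> 0)
  (fun M => M%:R^-1 * N%:R + M%:R^-1 * \sum_(1 <= j < M.+1) c T j)).
- near=> M; apply/andP; split.
    by rewrite mulr_ge0 ?invr_ge0 // sumr_ge0 // => j _; apply: c0.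
  rewrite -mulrDr ler_wpM2l ?invr_ge0 //.
  apply: le_trans (lerD (cN M) (lexx _)); rewrite -big_split /=.
  by apply: ler_sum => j _; apply: cST.
- exact: cvg_cst.
- have h : (fun M => M%:R^-1 * N%:R : R) @ \oo --> (0 : R).
    rewrite -cvg_shiftS.
    have : (harmonic M * N%:R : R) @[M --> \oo] --> (0 * N%:R : R).
      exact: cvgM (@cvg_harmonic R) (cvg_cst _).
    by rewrite mul0r.
  by have := cvgD h hT; rewrite addr0; apply.
Unshelve. all: by end_near. Qed.

Lemma exprn_ge_bernoulli (r : R) m : 0 <= r <= 1 -> 1 - m%:R * (1 - r) <= r ^+ m.
Proof.
move=> /andP[r0 r1]; elim: m => [|m IH]; first by rewrite mul0r subr0.
have rm : r ^+ m <= 1 by rewrite exprn_ile1.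
rewrite exprS -natr1; nra.
Qed.

(** Closeness of q to 1 is enough, since q < p <= 1 forces p and q / p to be at least as close. *)
Lemma Mtilde_unif (f : R -> R) (eps : R) : continuous f -> 0 < eps ->
  exists N d, 0 < d /\ forall n p q x, (N <= n)%N -> 0 < q -> q < p -> p <= 1 ->
    `|q - 1| < d -> 0 <= x <= 1 -> `|Mtilde p q n f x - f x| <= eps.
Proof.
move=> cf eps0.
have e2 : 0 < eps / 2 by lra.
have [h h0 hf] := @continuous_unif_segment f 0 1 _ cf e2.
have [B B0 hB] := @continuous_bounded_segment f 0 2 cf.
(* Chosen so that K (h/2)^2 = 2B, which covers the points s with |s - x| >= h/2. *)
pose K := 8 * B / h ^+ 2.
have h2 : 0 < h ^+ 2 by rewrite exprn_gt0.
have K0 : 0 <= K by rewrite divr_ge0 ?mulr_ge0 // ltW.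
(* With [n] >= m/2 this gives 8K/[n] <= 16K/m <= eps/2. *)
pose m := (Num.bound (32 * K / eps)).+1.
have m0 : 0 < m%:R :> R by rewrite ltr0n.
have mK : 32 * K / eps <= m%:R.
  rewrite ltW //; apply: lt_trans (archi_boundP _) _; last by rewrite ltr_nat.
  by apply: divr_ge0; [apply: mulr_ge0|exact: ltW].
(* In turn: 1/p <= 2, so the nodes stay in [0, 2]; 1/p - 1 <= 2(1-p) <= h/2; and r^m >= 1/2 by the
   Bernoulli inequality. *)
pose d := Num.min (2^-1) (Num.min (h / 4) (2 * m%:R)^-1).
exists m, d; split.
  rewrite !lt_min invr_gt0 divr_gt0 // invr_gt0 mulr_gt0 //.
  by rewrite ltr0n.
move=> n p q x mn q0 qp p1; rewrite !lt_min => /and3P[q2 q4 qm] /andP[x0 x1].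
have [->|x1'] := eqVneq x 1.
  by rewrite /Mtilde eqxx subrr normr0 ltW.
have p0 : 0 < p by lra.
have q1 : `|q - 1| = 1 - q by rewrite distrC ger0_norm //; lra.
rewrite q1 in q2 q4 qm.
have pV : p^-1 - 1 <= 2 * (1 - p).
  have pV2 : p^-1 <= 2.
    by rewrite -[2]invrK lef_pV2 ?posrE ?invr_gt0 //; lra.
  have -> : p^-1 - 1 = (1 - p) * p^-1 by field; rewrite gt_eqF.
  rewrite [X in _ <= X]mulrC ler_wpM2l //; lra.
have pV1 : 1 <= p^-1 by rewrite invf_ge1.
set r := q / p.
have r0 : 0 < r by rewrite divr_gt0.
have r1 : r < 1 by rewrite ltr_pdivrMr ?mul1r.
have rq : q <= r by rewrite ler_peMr // ltW.
have rm : 2^-1 <= r ^+ m.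
  apply: le_trans (exprn_ge_bernoulli r m _); last by rewrite !ltW.
  have : m%:R * (1 - r) <= m%:R * (2 * m%:R)^-1.
    by apply: ler_wpM2l; [exact: ltW|lra].
  have -> : m%:R * (2 * m%:R)^-1 = 2^-1 :> R by field; rewrite gt_eqF.
  lra.
have Nm : m%:R / 2 <= pq_int 1 r n.
  apply: le_trans (qint_ge r r0 r1 m n mn).
  by apply: ler_wpM2l => //; exact: ltW.
have Kn : K * (8 / pq_int 1 r n) <= eps / 2.
  have N0 : 0 < pq_int 1 r n by apply: lt_le_trans Nm; rewrite divr_gt0.
  rewrite mulrA ler_pdivrMr //.
  apply: (@le_trans _ _ (eps / 2 * (m%:R / 2))); last by rewrite ler_pM2l.
  move: mK; rewrite ler_pdivrMr //; lra.
have -> : eps = eps / 2 + eps / 2 by lra.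
apply: (@le_trans _ _ (eps / 2 + K * (8 / pq_int 1 r n))); last by rewrite lerD2l.
apply: Mtilde_dist_le => //.
- exact: leq_trans mn.
- by rewrite x0 lt_neqAle x1'.
- exact: ltW.
move=> s /andP[s0 s1].
have sp : s <= s / p <= s + h / 2.
  apply/andP; split; first by rewrite ler_peMr.
  have -> : s / p = s + s * (p^-1 - 1) by ring.
  rewrite lerD2l; apply: (@le_trans _ _ (p^-1 - 1)); last by lra.
  by rewrite ler_piMl // subr_ge0.
have [sx|sx] := ltP `|s - x| (h / 2).
  rewrite distrC; apply: (@le_trans _ _ (eps / 2)); last first.
    by rewrite lerDl mulr_ge0 // sqr_ge0.
  apply/ltW/hf; first by rewrite x0.
  have := ler_distD s x (s / p); rewrite (distrC x s).
  have : `|s - s / p| <= h / 2 by rewrite distrC ger0_norm; lra.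
  lra.
have p2 : s / p <= 2.
  by apply: (@le_trans _ _ (1 / p)); rewrite ?ler_pM2r ?invr_gt0 //; lra.
have b1 : `|f (s / p)| <= B by apply: hB; lra.
have b2 : `|f x| <= B by apply: hB; lra.
apply: (le_trans (ler_normB _ _)).
apply: (@le_trans _ _ (2 * B)); first lra.
apply: (@le_trans _ _ (K * (h / 2) ^+ 2)).
  have -> : K * (h / 2) ^+ 2 = 2 * B by rewrite /K; field; rewrite gt_eqF.
  by [].
have : K * (h / 2) ^+ 2 <= K * (s - x) ^+ 2.
  apply: ler_wpM2l => //; rewrite -[(s - x) ^+ 2]real_normK ?num_real //.
  by rewrite ler_sqr ?nnegrE //; lra.
lra.
Qed.

End Uniform.

(** An element of C[0,1] is represented by a continuous extension to the line; the node 1 / p lies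
    beyond 1 when p < 1. *)
Theorem theorem5 (R : realType) (p q : nat -> R) (a b : R)
  (hq0 : forall n, 0 < q n) (hqp : forall n, q n < p n) (hp1 : forall n, p n <= 1)
  (hq : st_lim q 1) (hqn : st_lim (fun n => q n ^+ n) a)
  (hp : st_lim p 1) (hpn : st_lim (fun n => p n ^+ n) b)
  (f : R -> R) (hf : continuous f) :
  st_lim (fun n => supnorm01 (fun x => Mtilde (p n) (q n) n f x - f x)) 0.
Proof.
move=> eps eps0.
have e2 : 0 < eps / 2 by lra.
have [N [d [d0 unif]]] := @Mtilde_unif R f _ hf e2.
(* From N on, an index with error at least eps must satisfy d <= |q_n - 1|. *)
apply: (@density_zero_eventually_sub _ _ _ N) (hq d d0) => n Nn.
have [//|qd] := leP d `|q n - 1|.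
rewrite subr0 /supnorm01; set E := [set _ | _ in _].
(* The point x = 1 contributes 0, so [E] is nonempty and its supremum is nonnegative. *)
have E0 : E 0.
  by exists 1; rewrite /= ?in_itv /= ?ler01 ?lexx // /Mtilde eqxx subrr normr0.
have Ele : ubound E (eps / 2).
  move=> _ [x /= xI <-]; apply: unif => //; by rewrite in_itv in xI.
have sup_le : sup E <= eps / 2 by apply: ge_sup => //; exists 0.
have sup_ge : 0 <= sup E by apply: ub_le_sup => //; exists (eps / 2).
by rewrite ger0_norm //; lra.
Qed.
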